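(* Let $\Gamma:[0,T]\rightrightarrows\mathbb R^d$ be a càdlàg nonempty convex-valued mapping. For every $x\in\mathbb R^d$, the function $y$ defined by $$y_t=\mathop{\mathrm{argmin}}_{x'\in\Gamma_t}d(x,x')$$ satisfies $y\in D(\Gamma)$ and $$y_{t-}=\mathop{\mathrm{argmin}}_{x'\in\vec\Gamma_t}d(x,x').$$ In particular, $$\Gamma_t=\mathrm{cl}\{y_t\mid y\in D(\Gamma)\},$$ and $\vec\Gamma$ is càglàd nonempty convex-valued with $$\vec\Gamma_t=\mathrm{cl}\{y_{t-}\mid y\in D(\Gamma)\}.$$
   Context: $T\in(0,+\infty]$; $d(\cdot,\cdot)$ is the Euclidean metric on $\mathbb R^d$. $D$ is the space of $\mathbb R^d$-valued càdlàg functions on $[0,T]$, $D(\Gamma)=\{y\in D\mid y_t\in\Gamma_t\ \forall t\}$, $y_-$ is the left-continuous version of $y$ and $y_{0-}:=0$. Let $\tau_r$ (resp. $\tau_l$) be the topology on $\mathbb R$ generated by the intervals $[s,t)$ (resp. $(s,t]$), $s<t$. $\Gamma$ is right-isc if $\Gamma^{-1}(O)=\{t\mid\Gamma_t\cap O\ne\emptyset\}$ is $\tau_r$-open for every open $O\subseteq\mathbb R^d$, and right-osc if its graph is closed in the product of $\tau_r$ and the usual topology of $\mathbb R^d$; it is càd (right-continuous) if both hold. Left-isc, left-osc and càg (left-continuous) are defined analogously with $\tau_l$. $\Gamma$ has limits from the left (làg) if $\liminf_{s\upuparrows t}\Gamma_s=\limsup_{s\upuparrows t}\Gamma_s$ for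 all $t$, where the limits are Painlevé–Kuratowski inner/outer limits taken along strictly increasing sequences $s\to t$; having limits from the right (làd) is analogous with strictly decreasing sequences. $\Gamma$ is càdlàg if it is càd and làg, and càglàd if it is càg and làd. Finally $\vec\Gamma_0:=\{0\}$ and $\vec\Gamma_t:=\liminf_{s\upuparrows t}\Gamma_s$ for $t>0$.
   Formalization: Added assumption: for every t>0 the left limit of Γ at t is nonempty. Without it the claim fails: d=1, T=1, Γ_s={1/(1-s)} for s<1, Γ_1={0} is càdlàg (empty left limit at 1), but D(Γ) is empty. The claimed nonemptiness of vec Γ makes the condition necessary. *)

(* Defs.v *)
(* MathComp-Analysis. *)
From HB Require Import structures.
From mathcomp Require Import all_boot all_order all_algebra.
From mathcomp Require Import all_classical all_reals all_analysis.
Import Order.TTheory GRing.Theory Num.Theory.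
Import numFieldNormedType.Exports.

Set Implicit Arguments.
Unset Strict Implicit.
Unset Printing Implicit Defensive.

Local Open Scope classical_set_scope.
Local Open Scope ring_scope.

(* Time is extended-real so that the horizon T = +oo is covered; functions and
   set-valued mappings are total on \bar R, and only their values on the time
   set I are ever used.  For T = +oo the interval "[0, T]" may be read either as
   [0, +oo] or as [0, +oo[; both are allowed. *)
Definition time_interval (R : realType) (T : \bar R) (I : set (\bar R)) : Prop :=
  I = [set t | (0 <= t <= T)%E] \/
  (T = +oo%E /\ I = [set t | (0 <= t < +oo)%E]).

(* The topologies tau_r and tau_l live on copies of \bar R.  On the real line
   they are the usual ones.  No interval [s, t[ contains +oo, so the singleton
   {+oo} has to be added to the generators of tau_r: +oo is then isolated,
   exactly as a finite T is in the trace of tau_r on [0, T].  The singleton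
   {-oo} plays the symmetric role for tau_l. *)
Definition rtime (R : realType) : Type := \bar R.
Definition ltime (R : realType) : Type := \bar R.

HB.instance Definition _ (R : realType) := Choice.copy (rtime R) (\bar R).
HB.instance Definition _ (R : realType) := Choice.copy (ltime R) (\bar R).

Definition rtime_subbase (R : realType) : set (set (rtime R)) :=
  [set A | (exists s t : \bar R, (s < t)%E /\ A = [set u | (s <= u < t)%E]) \/
           A = [set +oo%E]].

Definition ltime_subbase (R : realType) : set (set (ltime R)) :=
  [set A | (exists s t : \bar R, (s < t)%E /\ A = [set u | (s < u <= t)%E]) \/
           A = [set -oo%E]].

HB.instance Definition _ (R : realType) :=
  @isSubBaseTopological.Build (rtime R) (set (rtime R)) (@rtime_subbase R) id.
HB.instance Definition _ (R : realType) :=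
  @isSubBaseTopological.Build (ltime R) (set (ltime R)) (@ltime_subbase R) id.

Section Defs.
Context {R : realType} {d : nat}.
Local Notation V := 'rV[R]_d.
Implicit Types (T t : \bar R) (I : set (\bar R)) (G : \bar R -> set V).
Implicit Types (y : \bar R -> V) (C : set V) (x : V).

(* The library norm on row vectors is the sup norm, hence this definition. *)
Definition edist (x x' : V) : R :=
  Num.sqrt (\sum_(i < d) (x ord0 i - x' ord0 i) ^+ 2).

Definition argmin_dist x C : set V :=
  [set z | C z /\ forall w, C w -> edist x z <= edist x w].

Definition left_nbhs_in I t : set_system (\bar R) :=
  within [set s | I s /\ (s < t)%E] (nbhs t).

Definition right_nbhs_in I t : set_system (\bar R) :=
  within [set s | I s /\ (t <= s)%E] (nbhs t).

Definition cadlag_fun I y : Prop :=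
  forall t, I t ->
    y s @[s --> right_nbhs_in I t] --> y t /\
    ((0 < t)%E -> cvg (y s @[s --> left_nbhs_in I t])).

Definition cadlag_selection I G : set (\bar R -> V) :=
  [set y | cadlag_fun I y /\ forall t, I t -> G t (y t)].

Definition left_version I y t : V :=
  if t == 0%E then 0 else lim (y s @[s --> left_nbhs_in I t]).

(* Gamma^{-1}(O), as a subset of the domain I. *)
Definition set_preimage I G (O : set V) : set (\bar R) :=
  [set t | I t /\ G t `&` O !=set0].

Definition set_graph I G : set (\bar R * V) :=
  [set p | I p.1 /\ G p.1 p.2].

(* Openness and closedness are relative to the domain of the mapping. *)
Definition right_isc I G : Prop :=
  forall O : set V, open O ->
    open (set_preimage I G O : set (subspace (I : set (rtime R)))).

Definition right_osc I G : Prop :=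
  closed (set_graph I G :
    set (subspace ((I : set (rtime R)) `*` [set: V]))).

Definition left_isc I G : Prop :=
  forall O : set V, open O ->
    open (set_preimage I G O : set (subspace (I : set (ltime R)))).

Definition left_osc I G : Prop :=
  closed (set_graph I G :
    set (subspace ((I : set (ltime R)) `*` [set: V]))).

(* Painleve-Kuratowski limits of a sequence of sets. *)
Definition pk_liminf (C : nat -> set V) : set V :=
  [set x | exists2 u : nat -> V,
     u n @[n --> \oo] --> x & \forall n \near \oo, C n (u n)].

Definition pk_limsup (C : nat -> set V) : set V :=
  [set x | exists phi : nat -> nat, increasing_seq phi /\
     exists2 u : nat -> V,
       u n @[n --> \oo] --> x & forall n, C (phi n) (u n)].

Definition seq_upto I t : set (nat -> \bar R) :=
  [set s | [/\ forall n, I (s n), increasing_seq s & s n @[n --> \oo] --> t]].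

Definition seq_downto I t : set (nat -> \bar R) :=
  [set s | [/\ forall n, I (s n), decreasing_seq s & s n @[n --> \oo] --> t]].

Definition left_liminf I G t : set V :=
  \bigcap_(s in seq_upto I t) pk_liminf (G \o s).
Definition left_limsup I G t : set V :=
  \bigcup_(s in seq_upto I t) pk_limsup (G \o s).
Definition right_liminf I G t : set V :=
  \bigcap_(s in seq_downto I t) pk_liminf (G \o s).
Definition right_limsup I G t : set V :=
  \bigcup_(s in seq_downto I t) pk_limsup (G \o s).

(* At t = 0 (resp. t = T) there are no sequences to take limits along. *)
Definition has_left_limits I G : Prop :=
  forall t, I t -> (0 < t)%E -> left_liminf I G t = left_limsup I G t.
Definition has_right_limits T I G : Prop :=
  forall t, I t -> (t < T)%E -> right_liminf I G t = right_limsup I G t.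

Definition cadlag_map I G : Prop :=
  [/\ right_isc I G, right_osc I G & has_left_limits I G].
Definition caglad_map T I G : Prop :=
  [/\ left_isc I G, left_osc I G & has_right_limits T I G].

Definition vec_map I G t : set V :=
  if t == 0%E then [set 0] else left_liminf I G t.

End Defs.

(* Main.v *)
From Pilot Require Import Defs.
From HB Require Import structures.
From mathcomp Require Import all_boot all_order all_algebra.
From mathcomp Require Import all_classical all_reals all_analysis.
From mathcomp Require Import ring lra.
Import Order.TTheory GRing.Theory Num.Theory.
Import numFieldNormedType.Exports.
Local Open Scope classical_set_scope.
Local Open Scope ring_scope.

(** The theorem rests on one continuity property of the Euclidean projection:
if sets [G s] converge to [C] in the sense of Painleve-Kuratowski and [x] has
a single nearest point [p] in [C], then nearest points of [x] in the [G s]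
converge to [p] ([argmin_dist_cvg]).  Indeed [p] is approached by points of
[G s], so the nearest points eventually stay in a compact ball and their
cluster points are no farther from [x] than [p] is; these cluster points
belong to [C], hence all equal [p].

To apply this, the assumptions on [G] are turned into convergence along
neighbourhood filters.  Right-isc and right-osc say that [G] converges to
[G t] along the right neighbourhoods of [t] ([right_isc_inner],
[right_osc_outer]).  The sequential left limits say that [G] converges to
[vec_map I G t] along the left neighbourhoods of [t] ([left_liminf_inner],
[left_limsup_outer]), because a property that holds frequently on the left of
[t] holds along a strictly increasing sequence ([exists_seq_upto]).
Convergence makes the limit sets closed, and [vec_map I G t] inherits convexity
from the values of [G], so projections on [G t] and on [vec_map I G t] exist
and are unique.  The projection of [x] on [G] is thus a cadlag selection whose
left limits are the projections on [vec_map I G] ([cadlag_projection]).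

Projecting a point [z] of [G t], or of [vec_map I G t], gives a selection that
passes through [z] at time [t], or whose left limit at [t] is [z]; the two
closure formulas follow, since the sets are closed.

For the regularity of [vec_map I G], a time close to [t] on either side has
all its own left neighbourhoods close to [t] on that side, so left limits taken
near [t] inherit any limit at [t] ([near_left_left], [near_right_left]).
Applied to sets avoiding a given neighbourhood, this is outer semicontinuity
of [vec_map I G] ([outer_along_left_limits]); applied to the selections through
a given point, it is inner semicontinuity ([cvg_left_limits]).  The limit from
the left is [vec_map I G t] itself, the limit from the right is [G t]. *)

(* Without this notation [edist] would denote the extended distance of
   pseudometric spaces. *)
Local Notation edist := Pilot.Defs.edist.

(** * Euclidean projection on a closed convex set *)

Section euclid.
Context {R : realType} {d : nat}.
Local Notation V := 'rV[R]_d.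
Implicit Types (x z w : V) (C : set V).

Lemma edist_ge0 x w : 0 <= edist x w.
Proof. exact: sqrtr_ge0. Qed.

Lemma edistxx x : edist x x = 0.
Proof.
rewrite /edist big1 ?sqrtr0// => i _.
by rewrite subrr expr0n.
Qed.

Lemma edist_sqr x w : edist x w ^+ 2 = \sum_(i < d) (x ord0 i - w ord0 i) ^+ 2.
Proof. by rewrite sqr_sqrtr// sumr_ge0// => i _; exact: sqr_ge0. Qed.

Lemma coord_le_edist x w i : `|x ord0 i - w ord0 i| <= edist x w.
Proof.
rewrite -sqrtr_sqr ler_sqrt; last by rewrite sumr_ge0// => j _; exact: sqr_ge0.
by rewrite (bigD1 i)//= lerDl sumr_ge0// => j _; exact: sqr_ge0.
Qed.

Lemma edist0_eq x w : edist x w <= 0 -> w = x.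
Proof.
move=> xw0; apply/rowP => i; apply/esym/eqP.
by rewrite -subr_eq0 -normr_le0 (le_trans (coord_le_edist _ _ _)).
Qed.

Lemma edist_continuous x : continuous (edist x).
Proof.
move=> w; apply: (@continuous_comp _ _ _
  (fun w : V => \sum_(i < d) (x ord0 i - w ord0 i) ^+ 2) Num.sqrt);
  last exact: sqrt_continuous.
apply: continuous_big => [|i _ {}w]; first exact: add_continuous.
apply: (@continuous_comp _ _ _ (fun w : V => x ord0 i - w ord0 i)
  (fun r => r ^+ 2)); last exact: exprn_continuous.
apply: continuousB; first exact: cst_continuous.
exact: coord_continuous.
Qed.

Lemma edist_ball_closed x (r : R) : closed [set w | edist x w <= r].
Proof.
have /continuous_closedP := @edist_continuous x.
by move=> /(_ _ (@closed_le _ r)).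
Qed.

Lemma edist_ball_nbhs x p (r : R) : edist x p < r ->
  nbhs p [set w | edist x w <= r].
Proof.
move=> /lt_nbhsl pr.
have : nbhs p [set w | edist x w < r] by exact: (@edist_continuous x p _ pr).
by apply: filterS => w /ltW.
Qed.

Lemma edist_ball_compact x (r : R) : compact [set w | edist x w <= r].
Proof.
apply: (subclosed_compact _ (@rV_compact _ _
    (fun i => `[x ord0 i - r, x ord0 i + r]%classic) _)).
- exact: edist_ball_closed.
- by move=> i; exact: segment_compact.
- move=> w /= xwr i; rewrite in_itv/= -ler_distl distrC.
  exact: le_trans (coord_le_edist _ _ _) xwr.
Qed.

(** The parallelogram identity for [x - a] and [x - b]; it makes the distance to
[x] strictly convex. *)
Lemma edist_midpoint x a b :
  4%:R * edist x (2^-1 *: a + 2^-1 *: b) ^+ 2 + edist a b ^+ 2 =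
  2%:R * edist x a ^+ 2 + 2%:R * edist x b ^+ 2.
Proof.
rewrite !edist_sqr !mulr_sumr -!big_split/=; apply: eq_bigr => i _.
by rewrite !mxE; field.
Qed.

(** By the parallelogram identity the midpoint of two distinct nearest points
would be strictly nearer. *)
Lemma argmin_dist_unique x C a b : @convex_set R V C ->
  argmin_dist x C a -> argmin_dist x C b -> a = b.
Proof.
move=> Cconv [Ca amin] [Cb bmin].
have half_ge0 : 0 <= 2^-1 :> R by rewrite invr_ge0.
have half_le1 : 2^-1 <= 1 :> R by rewrite invf_le1// ler1n.
have := Cconv a b (Itv01 half_ge0 half_le1); rewrite !inE => /(_ Ca Cb).
have -> : conv (Itv01 half_ge0 half_le1) (a : convex_lmodType V) b =
    2^-1 *: a + 2^-1 *: b.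
  change (2^-1 *: a + (1 - 2^-1) *: b = 2^-1 *: a + 2^-1 *: b).
  by congr (_ + _ *: _); field.
move=> Cm; have ma := amin _ Cm; have ab := amin _ Cb; have ba := bmin _ Ca.
have eqab : edist x a = edist x b by apply/eqP; rewrite eq_le ab ba.
have := edist_midpoint x a b; rewrite -eqab.
have : edist x a ^+ 2 <= edist x (2^-1 *: a + 2^-1 *: b) ^+ 2.
  by rewrite ler_sqr ?nnegrE ?edist_ge0.
move=> le2 mid; apply/esym/edist0_eq.
rewrite leNgt; apply/negP => ab_gt0.
have : 0 < edist a b ^+ 2 by rewrite exprn_gt0.
by move: le2 mid; lra.
Qed.

(** Only the part of [C] in the ball through one of its points matters, and that
part is compact. *)
Lemma argmin_dist_exists x C : closed C -> C !=set0 ->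
  exists p, argmin_dist x C p.
Proof.
move=> Ccl [c Cc].
have [|||p pK pmin] := @compact_EVT_min _ _ (edist x)
   (C `&` [set w | edist x w <= edist x c]).
- by exists c; split=> /=.
- rewrite setIC; apply: compact_closedI => //; exact: edist_ball_compact.
- by apply: continuous_subspaceT; exact: edist_continuous.
move: pK; rewrite inE => -[Cp /= pc]; exists p; split => // w Cw.
have [wc|/ltW cw] := leP (edist x w) (edist x c).
  by apply: pmin; rewrite inE.
exact: le_trans cw.
Qed.

Lemma argmin_dist_set1 x C p : @convex_set R V C -> argmin_dist x C p ->
  argmin_dist x C = [set p].
Proof.
move=> Cconv pmin; apply/seteqP; split=> [w wmin | _ -> //].
exact: argmin_dist_unique wmin pmin.
Qed.

Lemma argmin_dist_self z C p : C z -> argmin_dist z C p -> p = z.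
Proof. by move=> Cz [_ /(_ _ Cz)]; rewrite edistxx => /edist0_eq. Qed.

End euclid.

(** * Painleve-Kuratowski convergence along a filter *)

Section along.
Context {R : realType} {d : nat} {S : Type}.
Local Notation V := 'rV[R]_d.
Implicit Types (F : set_system S) (G : S -> set V) (C : set V) (y : S -> V).

(** [C] is included in the Painleve-Kuratowski inner limit of [G] along [F]. *)
Definition inner_along F G C := forall z (U : set V), C z -> nbhs z U ->
  \forall s \near F, G s `&` U !=set0.

(** The Painleve-Kuratowski outer limit of [G] along [F] is included in [C], in
contrapositive form: points outside [C] have a neighbourhood that [G]
eventually avoids. *)
Definition outer_along F G C := forall z, ~ C z ->
  exists2 U : set V, nbhs z U & \forall s \near F, G s `&` U = set0.

Lemma outer_along_lim F {FF : ProperFilter F} G C y z : outer_along F G C ->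
  y @ F --> z -> (\forall s \near F, G s (y s)) -> C z.
Proof.
move=> out yz Gy; apply: contrapT => /out[U zU GU0].
have yU : \forall s \near F, U (y s) by exact: yz.
have [s [[Gs Us] GUs0]] := filter_ex (filterI (filterI Gy yU) GU0).
by rewrite -[False]/(set0 (y s)) -GUs0.
Qed.

(** Near a point of the closure of [C] there are points of [C], which the sets
[G s] approach; so the sets cannot avoid any neighbourhood of that point. *)
Lemma along_closed F {FF : ProperFilter F} G C :
  inner_along F G C -> outer_along F G C -> closed C.
Proof.
move=> inn out z Cz; apply: contrapT => /out[U zU GU0].
move: zU; rewrite nbhsE => -[W [Wop Wz] WU].
have [w [Cw Ww]] := Cz W (open_nbhs_nbhs (conj Wop Wz)).
have GW := inn w W Cw (open_nbhs_nbhs (conj Wop Ww)).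
have [s [[v [Gv Wv]] GUs0]] := filter_ex (filterI GW GU0).
by rewrite -[False]/(set0 v) -GUs0; split => //; exact: WU.
Qed.

(** Continuity of the projection under convergence of sets.  Uniqueness of
the nearest point in the limit set is what makes all cluster points agree. *)
Lemma argmin_dist_cvg F {FF : ProperFilter F} G C y x p :
  inner_along F G C -> outer_along F G C ->
  (\forall s \near F, argmin_dist x (G s) (y s)) ->
  argmin_dist x C = [set p] -> y @ F --> p.
Proof.
move=> inn out ymin Cp.
have pmin : argmin_dist x C p by rewrite Cp.
have [pC _] := pmin.
have near_ball e : 0 < e -> \forall s \near F, edist x (y s) <= edist x p + e.
  move=> e0.
  have pU : nbhs p [set w | edist x w <= edist x p + e].
    by apply/edist_ball_nbhs; rewrite ltrDl.
  apply: filterS2 ymin (inn p _ pC pU) => s [_ smin] [w [Gw /= wx]].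
  exact: le_trans (smin _ Gw) wx.
(* A cluster point is in [C] by outer convergence and, the balls around [x]
   being closed, at distance at most [edist x p] from [x]. *)
have clp q : cluster (y @ F) q -> q = p.
  move=> clq.
  have Cq : C q.
    apply: contrapT => /out[U qU GU0].
    have yU : (y @ F) (~` U).
      apply: filterS2 ymin GU0 => s [Gy _] GU0 Uy.
      by rewrite -[False]/(set0 (y s)) -GU0.
    by have [w []] := clq _ _ yU qU.
  have : argmin_dist x C q.
    split=> // w Cw; apply: le_trans (pmin.2 _ Cw).
    apply/ler_addgt0Pr => e e0.
    apply: (@edist_ball_closed _ _ x (edist x p + e)) => B qB.
    exact: clq (near_ball _ e0) qB.
  by rewrite Cp.
have FK : (y @ F) [set w | edist x w <= edist x p + 1] by exact: near_ball.
have cK := @edist_ball_compact _ _ x (edist x p + 1).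
apply: (compact_cluster_set1 _ cK) => //.
- by apply/edist_ball_nbhs; rewrite ltrDl.
- have [q [_ clq]] := cK _ _ FK.
  apply/seteqP; split=> [w /clp//|_ ->].
  by rewrite -(clp _ clq).
Qed.

End along.

(** * One-sided neighbourhoods of a time *)

Section time.
Context {R : realType}.
Implicit Types (s t u : \bar R) (I : set (\bar R)).

Lemma ereal_dense s t : (s < t)%E -> exists u, (s < u < t)%E.
Proof.
move: s t => [s||] [t||] //= st.
- exists (((s + t) / 2)%:E); move: st; rewrite !lte_fin => st.
  by rewrite !midf_lt.
- by exists (s + 1)%:E; rewrite lte_fin ltry ltrDl ltr01.
- by exists (t - 1)%:E; rewrite lte_fin ltNyr gtrBl ltr01.
- by exists 0%E; rewrite ltry ltNyr.
Qed.

Lemma nbhs_left_itv t (U : set (\bar R)) : nbhs t U -> (-oo < t)%E ->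
  exists2 r, (r < t)%E & forall s, (r < s <= t)%E -> U s.
Proof.
case: t => [t||] //= tU _.
- have /nbhs_ballP[e /= e0 eU] : nbhs t (fun r => U r%:E) := tU.
  exists (t - e)%:E; first by rewrite lte_fin gtrBl.
  move=> [s||]; last by rewrite ltNge leNye.
    2: by rewrite leye_eq andbF.
  rewrite lte_fin lee_fin => /andP[es st].
  by apply: eU; rewrite /ball/= ger0_norm ?subr_ge0// ltrBlDl -ltrBlDr.
- have [M [_ MU]] : exists M, M \is Num.real /\ forall s, (M%:E < s)%E -> U s.
    exact: tU.
   exists M%:E; first exact: ltry.
  by move=> s /andP[/MU].
Qed.

(** Each generator of the right topology that contains [t] contains all times
[s >= t] close to [t] in the usual topology. *)
Lemma rtime_nbhsW t (B : set (rtime R)) : nbhs (t : rtime R) B ->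
  \forall s \near t, (t <= s)%E -> B s.
Proof.
rewrite nbhsE => -[W [[D' D'sub <-] [A AD' At]] WB].
have [E Esub EA] := D'sub _ AD'.
suff tA : within [set s | (t <= s)%E] (nbhs t) A.
  apply: filterS (tA : nbhs t _) => s As ts.
  by apply: WB; exists A => //; exact: As.
move: At; rewrite -EA /= => Et.
apply: filter_bigI => /= i iE.
have := Et _ iE; have := Esub _ iE; rewrite inE => -[[a [b [ab ->]]]|->] /=.
- move=> /andP[at_ tb]; rewrite /within/=.
  have : nbhs t [set s | (s < b)%E] by exact: open_ereal_lt'.
  by apply: filterS => s /= sb ts; rewrite (le_trans at_ ts).
- move=> ->; apply: nearW => s /=; rewrite leye_eq => /eqP; exact.
Qed.

Lemma ltime_subbase_open (A : set (ltime R)) : ltime_subbase A -> open A.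
Proof.
move=> DA; exists [set A]; last by rewrite bigcup_set1.
by move=> _ ->; exact: (@finI_from1 _ _ _ id).
Qed.

(** A set containing all times [s <= t] close to [t] contains a half-open interval
ending at [t], which is a generator of the left topology. *)
Lemma ltime_nbhsW t (B : set (ltime R)) : (-oo < t)%E ->
  (\forall s \near t, (s <= t)%E -> B s) -> nbhs (t : ltime R) B.
Proof.
move=> tNy /nbhs_left_itv/(_ tNy)[r rt rB].
rewrite nbhsE; exists [set u | (r < u <= t)%E].
  split; last by rewrite /= rt lexx.
  by apply: ltime_subbase_open; left; exists r, t.
by move=> s /= /[dup] rst /rB; apply; case/andP: rst.
Qed.

End time.

Section time_interval_theory.
Context {R : realType}.
Implicit Types (s t u T : \bar R) (I : set (\bar R)).

Lemma time_ge0 T I t : time_interval T I -> I t -> (0 <= t)%E.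
Proof. by case=> [->|[_ ->]] /= /andP[]. Qed.

Lemma time_down T I s t : time_interval T I -> I t -> (0 <= s)%E ->
  (s <= t)%E -> I s.
Proof.
case=> [->|[_ ->]] /= /andP[t0 tT] s0 st; rewrite s0/=.
- exact: le_trans st tT.
- exact: le_lt_trans st tT.
Qed.

Lemma time_later T I t : time_interval T I -> I t -> (t < T)%E ->
  exists2 u, I u & (t < u)%E.
Proof.
case=> [->|[-> ->]] /= /andP[t0 tT] ltT.
- by exists T => //=; rewrite (le_trans t0 tT) lexx.
- have [u /andP[tu uy]] := ereal_dense _ _ tT.
  by exists u => //=; rewrite (le_trans t0 (ltW tu)).
Qed.

Lemma left_nbhs_proper T I t : time_interval T I -> I t -> (0 < t)%E ->
  ProperFilter (left_nbhs_in I t).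
Proof.
move=> TI It t0; apply: Build_ProperFilter_ex => P tP.
have tNy : (-oo < t)%E by exact: lt_trans t0.
have [r rt rP] := nbhs_left_itv _ _ tP tNy.
have [|s /andP[rs st]] := @ereal_dense _ (maxe 0%E r) t.
  by rewrite gt_max t0 rt.
move: rs; rewrite gt_max => /andP[s0 rs]; exists s.
apply: rP; first by rewrite rs ltW.
by split=> //; apply: time_down TI It _ _; exact: ltW.
Qed.

Lemma right_nbhs_proper I t : I t -> ProperFilter (right_nbhs_in I t).
Proof.
move=> It; apply: Build_ProperFilter_ex => P tP; exists t.
by apply: (nbhs_singleton tP) => /=.
Qed.

End time_interval_theory.

(** * Sequential left limits as filter limits *)

Section left_limits.
Context {R : realType} {d : nat}.
Local Notation V := 'rV[R]_d.
Implicit Types (t : \bar R) (I : set (\bar R)) (G : \bar R -> set V).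

(** A property that is frequent on the left of [t] can be realised along a
strictly increasing sequence: each term is chosen after the previous one and
within distance [1 / n.+1] of [t]. *)
Lemma exists_seq_upto I t (P : nat -> set (\bar R)) : (-oo < t)%E ->
  (forall n, ~ \forall s \near left_nbhs_in I t, ~ P n s) ->
  exists2 s, seq_upto I t s & forall n, P n (s n).
Proof.
move=> tNy freqP.
have next (na : nat * \bar R) : exists s, (na.2 < t)%E ->
    [/\ I s, (na.2 < s < t)%E, ball t na.1.+1%:R^-1 s & P na.1 s].
  case: na => n a /=; have [at_|ta] := ltP a t; last by exists t.
  apply: contrapT => /forallNP noP; apply: (freqP n).
  have ta : nbhs t [set s | (a < s)%E] by exact: open_ereal_gt'.
  have tb : nbhs t (ball t (n.+1%:R^-1 : R)) by exact: nbhsx_ballx.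
  apply: filterS2 ta tb => s /= as_ bs [Is st] Ps.
  by apply: (noP s) => _; split => //; rewrite as_.
have [f fP] := choice next.
(* The start value -oo is below t, so the first term is unconstrained. *)
pose s := fix s n := f (n, if n is m.+1 then s m else -oo%E).
have sSE n : s n.+1 = f (n.+1, s n) by [].
have st n : (s n < t)%E.
  elim: n => [|n ih]; first by have [_ /andP[]] := fP (0%N, -oo%E) tNy.
  by rewrite sSE; have [_ /andP[]] := fP (n.+1, s n) ih.
have sP n : [/\ I (s n), ball t n.+1%:R^-1 (s n) & P n (s n)].
  case: n => [|n]; first by have [] := fP (0%N, -oo%E) tNy.
  by rewrite sSE; have [] := fP (n.+1, s n) (st n).
exists s => [|n]; last by have [] := sP n.
split=> [n||]; first by have [] := sP n.
- apply/increasing_seqP => n; rewrite sSE.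
  by have [_ /andP[]] := fP (n.+1, s n) (st n).
- apply/cvg_ballP => e e0; near=> n.
  have [_ + _] := sP n; apply: le_ball; apply/ltW.
  by near: n; exact: (near_infty_natSinv_lt (PosNum e0)).
Unshelve. all: by end_near. Qed.

(** If the sets missed a neighbourhood of a point of the inner limit arbitrarily
close to [t], they would miss it along a whole sequence increasing to [t]. *)
Lemma left_liminf_inner I G t : (-oo < t)%E ->
  inner_along (left_nbhs_in I t) G (left_liminf I G t).
Proof.
move=> tNy z U Gz zU; apply: contrapT => notU.
have [|s sup sP] := @exists_seq_upto I t
    (fun=> [set s | ~ (G s `&` U !=set0)]) tNy.
  by move=> _ nn; apply: notU; apply: filterS nn => s; exact: contrapT.
have [u uz Gu] := Gz s sup.
have [n [Gn Un]] := filter_ex (filterI Gu (uz _ zU)).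
by apply: (sP n); exists (u n).
Qed.

(** If the sets met every ball around [z] arbitrarily close to [t], choosing points
in shrinking balls along an increasing sequence would make [z] an outer limit. *)
Lemma left_limsup_outer I G t : (-oo < t)%E ->
  outer_along (left_nbhs_in I t) G (left_limsup I G t).
Proof.
move=> tNy z; apply: contra_notP => noU.
pose B n : set V := ball z (n.+1%:R^-1 : R).
have [|s sup sP] := @exists_seq_upto I t
    (fun n => [set s | G s `&` B n !=set0]) tNy.
  move=> n nn; apply: noU; exists (B n); first exact: nbhsx_ballx.
  by apply: filterS nn => s /nonemptyPn.
have [u uP] := choice sP.
exists s => //; exists id; split => //.
exists u; last by move=> n; have [] := uP n.
apply/cvg_ballP => e e0; near=> n.
have [_] := uP n; apply: le_ball; apply/ltW.
by near: n; exact: (near_infty_natSinv_lt (PosNum e0)).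
Unshelve. all: by end_near. Qed.

Lemma left_liminf_convex I G t : (forall s, I s -> @convex_set R V (G s)) ->
  @convex_set R V (left_liminf I G t).
Proof.
move=> Gconv a b k; rewrite !inE => Ga Gb s sup.
have [u ua Gu] := Ga s sup; have [v vb Gv] := Gb s sup.
exists (fun n => conv k (u n : convex_lmodType V) (v n)).
  by apply: cvgD; apply: cvgZr.
apply: filterS2 Gu Gv => n Gun Gvn; have [Is _ _] := sup.
by have := Gconv _ (Is n) (u n) (v n) k; rewrite !inE; exact.
Qed.

End left_limits.

(** * Iterated limits and one-sided semicontinuity *)

Section iterated_limits.
Context {R : realType} {d : nat}.
Local Notation V := 'rV[R]_d.
Implicit Types (t : \bar R) (I : set (\bar R)) (G H : \bar R -> set V).

(** Unlike the right neighbourhoods of cadlag functions, these exclude [t]: the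
value of a left version at [t] is unrelated to its limit from the right. *)
Definition strict_right_nbhs_in I t : set_system (\bar R) :=
  within [set s | I s /\ (t < s)%E] (nbhs t).

(** Times [u < s < t] near [s] are times on the left of [t] near [t]. *)
Lemma near_left_left I t (Q : set (\bar R)) : left_nbhs_in I t Q ->
  \forall s \near left_nbhs_in I t, left_nbhs_in I s Q.
Proof.
move=> /near_join; apply: filterS => s sQ [Is st].
apply: filterS sQ => u uQ [Iu us]; apply: uQ; split=> //.
exact: lt_trans st.
Qed.

(** If [t < s], the times [u < s] near [s] are eventually greater than [t]. *)
Lemma near_right_left I t (Q : set (\bar R)) : right_nbhs_in I t Q ->
  \forall s \near strict_right_nbhs_in I t, left_nbhs_in I s Q.
Proof.
move=> /near_join; apply: filterS => s sQ [Is st].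
have tu : nbhs s [set u | (t < u)%E] by exact: open_ereal_gt'.
by apply: filterS2 sQ tu => u uQ tu [Iu us]; apply: uQ; split=> //; exact: ltW.
Qed.

Context {I : set (\bar R)} {F0 F1 : set_system (\bar R)}.
Hypothesis F1filter : Filter F1.
Hypothesis F01 : forall Q, F0 Q -> \forall s \near F1, left_nbhs_in I s Q.
Hypothesis F1proper : \forall s \near F1, ProperFilter (left_nbhs_in I s).

(** The space is regular, so closed neighbourhoods of [p] suffice, and a left limit
at [s] stays in a closed set that contains [y] on the left of [s]. *)
Lemma cvg_left_limits (y l : \bar R -> V) (p : V) : y @ F0 --> p ->
  (\forall s \near F1, y @ left_nbhs_in I s --> l s) -> l @ F1 --> p.
Proof.
move=> yp yl U pU; have [W pW WU] := @uniform_regular V p U pU.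
have := F01 _ (yp _ pW) => FW.
apply: filterS3 FW F1proper yl => s sW sF sl; apply: WU.
have sclW : \forall u \near left_nbhs_in I s, closure W (y u).
  by apply: filterS sW => u Wu; exact: (@subset_closure _ W) Wu.
exact: closed_cvg (@closed_closure _ W) sclW _ sl.
Qed.

(** An open set avoided by [G] on the left of [s] cannot meet the inner limit
[H s]. *)
Lemma outer_along_left_limits G H C : outer_along F0 G C ->
  (\forall s \near F1, inner_along (left_nbhs_in I s) G (H s)) ->
  outer_along F1 H C.
Proof.
move=> out inn z /out[U]; rewrite {1}nbhsE => -[W [Wop Wz] WU] GU0.
exists W; first exact: open_nbhs_nbhs (conj Wop Wz).
apply: filterS3 (F01 _ GU0) F1proper inn => s sGU sF sinn.
apply/seteqP; split=> // w [Hw Ww].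
have sW := sinn w W Hw (open_nbhs_nbhs (conj Wop Ww)).
have [u [[v [Gv Wv]] GU]] := filter_ex (filterI sW sGU).
suff : (G u `&` U) v by rewrite GU.
by split => //; exact: WU.
Qed.

End iterated_limits.

Section semicontinuity.
Context {R : realType} {d : nat}.
Local Notation V := 'rV[R]_d.
Implicit Types (t : \bar R) (I : set (\bar R)) (G : \bar R -> set V).

Lemma right_isc_inner I G t : right_isc I G -> I t ->
  inner_along (right_nbhs_in I t) G (G t).
Proof.
move=> isc It z U Gz; rewrite nbhsE => -[W [Wop Wz] WU].
have /open_subspaceP[B Bop BI] := isc W Wop.
have Bt : B t.
  suff : (B `&` I) t by case.
  by rewrite BI; split=> //; split=> //; exists z.
have tB : nbhs (t : rtime R) B by exact: open_nbhs_nbhs (conj Bop Bt).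
apply: filterS (rtime_nbhsW _ _ tB) => s Bs [Is ts].
have : (B `&` I) s by split=> //; exact: Bs.
by rewrite BI => -[[_ [w [Gw Ww]]] _]; exists w; split=> //; exact: WU.
Qed.

Lemma right_osc_outer I G t : right_osc I G -> I t ->
  outer_along (right_nbhs_in I t) G (G t).
Proof.
move=> osc It z Gz.
have /closed_subspaceP[B Bcl BI] := osc.
have nB : ~ B (t, z).
  move=> Btz; have : (B `&` ((I : set (rtime R)) `*` [set: V])) (t, z) by [].
  by rewrite BI => -[[]].
have : nbhs ((t : rtime R), z) (~` B).
  by apply: open_nbhs_nbhs; split=> //; exact: closed_openC.
move=> [[P U] [/= tP zU] PU]; exists U => //.
apply: filterS (rtime_nbhsW _ _ tP) => s Ps [Is ts].
apply/seteqP; split=> // w [Gw Uw].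
apply: (PU (s, w)); first by split=> //=; exact: Ps.
suff : (B `&` ((I : set (rtime R)) `*` [set: V])) (s, w) by case.
by rewrite BI.
Qed.

(** A left neighbourhood in the topology of [ltime] is the point itself together
with the times strictly before it. *)
Lemma ltime_nbhs_left I t (Q : set (ltime R)) : (-oo < t)%E -> Q t ->
  left_nbhs_in I t Q -> \forall s \near (t : ltime R), I s -> Q s.
Proof.
move=> tNy Qt tQ; apply: ltime_nbhsW => //.
apply: filterS (tQ : nbhs t _) => s sQ.
rewrite /= le_eqVlt => /orP[/eqP -> //|st] Is.
exact: sQ.
Qed.

Lemma inner_left_isc I G : (forall t, I t -> (-oo < t)%E) ->
  (forall t, I t -> inner_along (left_nbhs_in I t) G (G t)) -> left_isc I G.
Proof.
move=> INy inn W Wop; rewrite openE => t [It [z [Gz Wz]]].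
rewrite /interior /nbhs/= -nbhs_subspace_in//.
have tW : \forall s \near (t : ltime R), I s -> G s `&` W !=set0.
  apply: ltime_nbhs_left; [exact: INy | by exists z |].
  exact: inn It _ _ Gz (open_nbhs_nbhs (conj Wop Wz)).
rewrite /within/=; apply: filterS tW => s sW Is.
by split=> //; exact: sW.
Qed.

(** The limit condition only concerns times before [t], so closedness of [G t] is
needed for the points of the graph at [t] itself. *)
Lemma outer_left_osc I G : (forall t, I t -> (-oo < t)%E) ->
  (forall t, I t -> closed (G t)) ->
  (forall t, I t -> outer_along (left_nbhs_in I t) G (G t)) -> left_osc I G.
Proof.
move=> INy Gcl out; rewrite /left_osc -openC openE => -[t z] Gtz.
rewrite /interior; have [It|nIt] := pselect (I t); last first.
  by rewrite /nbhs/= -nbhs_subspace_out; [move=> _ -> | case].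
rewrite /nbhs/= -nbhs_subspace_in//.
have Gz : ~ G t z by move=> Gz; apply: Gtz.
have [U zU tU] := out t It z Gz.
pose Q := [set s : ltime R | G s `&` (U `&` ~` G t) = set0].
have tQ : \forall s \near (t : ltime R), I s -> Q s.
  apply: ltime_nbhs_left; first exact: INy.
    by apply/seteqP; split=> // w [? []].
  by apply: filterS tU => s GU; rewrite /Q/= setIA GU set0I.
exists ([set s : ltime R | I s -> Q s], U `&` ~` G t).
  split=> //=; apply: filterI => //.
  by apply: open_nbhs_nbhs; split=> //; apply: closed_openC; exact: Gcl.
move=> [s w] /= [sQ Uw] [Is _] [_ /= Gw].
suff : (G s `&` (U `&` ~` G t)) w by rewrite sQ.
by [].
Qed.

End semicontinuity.

(** * The projection selections and the left-limit mapping *)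

Section sequences_from_the_right.
Context {R : realType}.
Implicit Types (t T : \bar R) (I : set (\bar R)).

(** The sequence [t + (v - t) / n.+1] for a finite [v] between [t] and a later
time. *)
Lemma exists_seq_downto T I t : time_interval T I -> I t -> (t < T)%E ->
  seq_downto I t !=set0.
Proof.
move=> TI It tT; have [u Iu tu] := time_later _ _ _ TI It tT.
have [v /andP[tv vu]] := ereal_dense _ _ tu.
have t0 := time_ge0 _ _ _ TI It.
have vfin : v \is a fin_num.
  rewrite fin_numElt (lt_trans _ (le_lt_trans t0 tv))//=.
  by rewrite (lt_le_trans vu) ?leey.
have tfin : t \is a fin_num.
  by rewrite fin_numElt (lt_le_trans _ t0)//= (lt_le_trans tv) ?leey.
move: It tv vu t0; rewrite -(fineK tfin) -(fineK vfin) lte_fin.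
move: (fine t) (fine v) => {tu tT vfin tfin}t {}v It tv vu t0.
pose s (n : nat) : R := t + (v - t) * n.+1%:R^-1.
have st : s @ \oo --> t.
  rewrite -[X in _ --> X]addr0 -[X in _ + X](mulr0 (v - t)).
  apply: cvgD; first exact: cvg_cst.
  by apply: cvgM; [exact: cvg_cst | exact: cvg_harmonic].
exists (fun n => (s n)%:E); split.
- move=> n; apply: (time_down _ _ _ _ TI Iu).
    by apply: le_trans t0 _; rewrite lee_fin lerDl mulr_ge0// subr_ge0 ltW.
  apply: le_trans (ltW vu); rewrite lee_fin -lerBrDl ler_piMr//.
    by rewrite subr_ge0 ltW.
  by rewrite invf_le1// ler1n.
- apply/decreasing_seqP => n; rewrite lte_fin ltrD2l ltr_pM2l ?subr_gt0//.
  by rewrite ltf_pV2 ?posrE// ltr_nat.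
- by move=> U tU; exact: (st _ tU).
Qed.

(** The terms exceed [t]: were a term at most [t], the next one would be smaller
than [t] and bound all later terms away from [t]. *)
Lemma seq_downto_cvg I t (s : nat -> \bar R) : seq_downto I t s ->
  s @ \oo --> strict_right_nbhs_in I t.
Proof.
move=> [Is sdec st] P tP.
have ts n : (t < s n)%E.
  rewrite ltNge; apply/negP => snt.
  have : nbhs t [set u | (s n.+1 < u)%E].
    apply: open_ereal_gt'; apply: lt_le_trans snt.
    by move/decreasing_seqP : sdec; apply.
  move=> /st[N _ sN].
  have := sN (maxn N n.+1) (leq_maxl _ _).
  by rewrite /= ltNge sdec leq_maxr.
have [N _ NP] := st _ tP; exists N => // n Nn.
by apply: (NP n Nn); split; [exact: Is | exact: ts].
Qed.

End sequences_from_the_right.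

Section cadlag_projection.
Context {R : realType} {d : nat} {T : \bar R} {I : set (\bar R)}
  {G : \bar R -> set 'rV[R]_d}.
Local Notation V := 'rV[R]_d.
Hypothesis I_time : time_interval T I.
Hypothesis G_cadlag : cadlag_map I G.
Hypothesis G_nonempty : forall t, I t -> G t !=set0.
Hypothesis G_convex : forall t, I t -> @convex_set R V (G t).
Hypothesis G_left_nonempty :
  forall t, I t -> (0 < t)%E -> left_limsup I G t !=set0.
Implicit Types (t : \bar R) (x z : V) (y : \bar R -> V).

Let vecG := vec_map I G.

Lemma time_cases t : I t -> t = 0%E \/ (0 < t)%E.
Proof.
by move/(time_ge0 _ _ _ I_time); rewrite le_eqVlt => /orP[/eqP|]; [left|right].
Qed.

Lemma vec_mapE t : (0 < t)%E -> vecG t = left_liminf I G t.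
Proof. by move=> t0; rewrite /vecG /vec_map gt_eqF. Qed.

Lemma vec_map0 : vecG 0%E = [set 0].
Proof. by rewrite /vecG /vec_map eqxx. Qed.

Lemma G_inner t : I t -> inner_along (right_nbhs_in I t) G (G t).
Proof. by case: G_cadlag => isc _ _; exact: right_isc_inner. Qed.

Lemma G_outer t : I t -> outer_along (right_nbhs_in I t) G (G t).
Proof. by case: G_cadlag => _ osc _; exact: right_osc_outer. Qed.

Lemma vec_inner t : I t -> (0 < t)%E ->
  inner_along (left_nbhs_in I t) G (vecG t).
Proof.
move=> It t0; rewrite vec_mapE//; apply: left_liminf_inner.
exact: lt_trans t0.
Qed.

Lemma vec_outer t : I t -> (0 < t)%E ->
  outer_along (left_nbhs_in I t) G (vecG t).
Proof.
case: G_cadlag => _ _ lag It t0; rewrite vec_mapE// lag//.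
by apply: left_limsup_outer; exact: lt_trans t0.
Qed.

Lemma G_closed t : I t -> closed (G t).
Proof.
move=> It; have tF := right_nbhs_proper _ _ It.
exact: along_closed (G_inner _ It) (G_outer _ It).
Qed.

Lemma vec_closed t : I t -> closed (vecG t).
Proof.
move=> It; have [->|t0] := time_cases _ It.
  rewrite vec_map0; apply: accessible_closed_set1.
  exact: hausdorff_accessible.
have tF := left_nbhs_proper _ _ _ I_time It t0.
exact: along_closed (vec_inner _ It t0) (vec_outer _ It t0).
Qed.

Lemma vec_convex t : I t -> @convex_set R V (vecG t).
Proof.
move=> It; have [->|t0] := time_cases _ It.
  by rewrite vec_map0 => a b k; rewrite !inE => -> ->; rewrite convmm.
by rewrite vec_mapE//; exact: left_liminf_convex.
Qed.

(** Convergence alone would allow an empty limit, as the sets may escape to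
infinity; hence the hypothesis on outer limits. *)
Lemma vec_nonempty t : I t -> vecG t !=set0.
Proof.
move=> It; have [->|t0] := time_cases _ It; first by rewrite vec_map0; exists 0.
by case: G_cadlag => _ _ lag; rewrite vec_mapE// lag//; exact: G_left_nonempty.
Qed.

Lemma left_version_cvg y t : cadlag_fun I y -> I t -> (0 < t)%E ->
  y @ left_nbhs_in I t --> left_version I y t.
Proof.
move=> ycad It t0; rewrite /left_version gt_eqF//.
exact: (ycad t It).2 t0.
Qed.

Lemma left_version_mem y t : cadlag_selection I G y -> I t ->
  vecG t (left_version I y t).
Proof.
move=> [ycad Gy] It; have [->|t0] := time_cases _ It.
  by rewrite vec_map0 /left_version eqxx.
have tF := left_nbhs_proper _ _ _ I_time It t0.
apply: (outer_along_lim (left_nbhs_in I t) G) (vec_outer _ It t0)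
  (left_version_cvg _ _ ycad It t0) _.
by apply: (@nearW _ (nbhs t)) => s [Is _]; exact: Gy.
Qed.

(** The pointwise projection is right-continuous because [G] converges to [G t]
from the right, and its left limits are the projections on the left limits of
[G]. *)
Lemma cadlag_projection x : exists y,
  [/\ forall t, I t -> argmin_dist x (G t) = [set y t],
      cadlag_selection I G y &
      forall t, I t -> argmin_dist x (vecG t) = [set left_version I y t]].
Proof.
have projG t : exists p, I t -> argmin_dist x (G t) = [set p].
  have [It|nIt] := pselect (I t); last by exists 0.
  have [p pmin] := argmin_dist_exists x _ (G_closed _ It) (G_nonempty _ It).
  by exists p => _; apply: argmin_dist_set1 => //; exact: G_convex.
have [y yE] := choice projG.
have ymin t : I t -> argmin_dist x (G t) (y t) by move=> It; rewrite yE.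
have yleft t p : I t -> (0 < t)%E -> argmin_dist x (vecG t) = [set p] ->
    y @ left_nbhs_in I t --> p.
  move=> It t0; have tF := left_nbhs_proper _ _ _ I_time It t0.
  apply: argmin_dist_cvg (vec_inner _ It t0) (vec_outer _ It t0) _.
  by apply: (@nearW _ (nbhs t)) => s [Is _]; exact: ymin.
have projvec t : I t -> exists p, argmin_dist x (vecG t) = [set p].
  move=> It.
  have [p pmin] := argmin_dist_exists x _ (vec_closed _ It) (vec_nonempty _ It).
  by exists p; apply: argmin_dist_set1 => //; exact: vec_convex.
have ycad : cadlag_fun I y.
  move=> t It; split.
    have tF := right_nbhs_proper _ _ It.
    apply: argmin_dist_cvg (G_inner _ It) (G_outer _ It) _ (yE _ It).
    by apply: (@nearW _ (nbhs t)) => s [Is _]; exact: ymin.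
  move=> t0; have [p pE] := projvec t It.
  by apply/cvg_ex; exists p; exact: yleft.
exists y; split=> //; first by split=> // t It; have [] := ymin t It.
move=> t It; have [p pE] := projvec t It; rewrite pE; congr [set _].
have [t0|t0] := time_cases _ It.
  have [+ _] : argmin_dist x (vecG t) p by rewrite pE.
  by rewrite t0 vec_map0 /left_version eqxx.
rewrite /left_version gt_eqF//; apply/esym.
have tF := left_nbhs_proper _ _ _ I_time It t0.
by apply: (cvg_lim (@norm_hausdorff _ V)); exact: yleft.
Qed.

(** Projecting [z] itself: at time [t] the nearest point is [z]. *)
Lemma selection_through z t : I t -> G t z ->
  exists2 y, cadlag_selection I G y & y t = z.
Proof.
move=> It Gz; have [y [yE ysel _]] := cadlag_projection z.
by exists y => //; apply: argmin_dist_self Gz _; rewrite yE.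
Qed.

Lemma selection_left_through z t : I t -> vecG t z ->
  exists2 y, cadlag_selection I G y & left_version I y t = z.
Proof.
move=> It Gz; have [y [_ ysel yE]] := cadlag_projection z.
by exists y => //; apply: argmin_dist_self Gz _; rewrite yE.
Qed.

Lemma near_left_pos t : I t -> (0 < t)%E -> \forall s \near left_nbhs_in I t,
  I s /\ (0 < s)%E.
Proof.
move=> It t0; have tpos : nbhs t [set s | (0 < s)%E] by exact: open_ereal_gt'.
by apply: (@filterS _ (nbhs t) _ _ _ _ tpos) => s s0 [].
Qed.

Lemma left_version_left_cvg y t : cadlag_fun I y -> I t -> (0 < t)%E ->
  left_version I y @ left_nbhs_in I t --> left_version I y t.
Proof.
move=> ycad It t0; have near0 := near_left_pos _ It t0.
apply: (cvg_left_limits _ (near_left_left I t) _ y).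
- by apply: filterS near0 => s [Is s0]; exact: left_nbhs_proper I_time Is s0.
- exact: left_version_cvg.
- by apply: filterS near0 => s [Is s0]; exact: left_version_cvg.
Qed.

Lemma near_right_pos t : I t -> \forall s \near strict_right_nbhs_in I t,
  I s /\ (0 < s)%E.
Proof.
move=> It; apply: (@nearW _ (nbhs t)) => s [Is ts]; split=> //.
exact: le_lt_trans (time_ge0 _ _ _ I_time It) ts.
Qed.

Lemma left_version_right_cvg y t : cadlag_fun I y -> I t ->
  left_version I y @ strict_right_nbhs_in I t --> y t.
Proof.
move=> ycad It; have near0 := near_right_pos _ It.
apply: (cvg_left_limits _ (near_right_left I t) _ y).
- by apply: filterS near0 => s [Is s0]; exact: left_nbhs_proper I_time Is s0.
- exact: (ycad t It).1.
- by apply: filterS near0 => s [Is s0]; exact: left_version_cvg.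
Qed.

(** The left version of a selection whose left limit at [t] is [z] is a
left-continuous selection of [vec_map I G]. *)
Lemma vec_left_inner t : I t -> inner_along (left_nbhs_in I t) vecG (vecG t).
Proof.
move=> It z U Gz zU; have [t0|t0] := time_cases _ It.
  apply: (@nearW _ (nbhs t)) => s [Is].
  by rewrite t0 ltNge (time_ge0 _ _ _ I_time Is).
have [y ysel yz] := selection_left_through _ _ It Gz.
have yU : \forall s \near left_nbhs_in I t, U (left_version I y s).
  by apply: (left_version_left_cvg _ _ ysel.1 It t0); rewrite yz.
apply: filterS2 yU (near_left_pos _ It t0) => s Us [Is _].
by exists (left_version I y s); split=> //; exact: left_version_mem.
Qed.

Lemma vec_left_outer t : I t -> outer_along (left_nbhs_in I t) vecG (vecG t).
Proof.
move=> It; have [t0|t0] := time_cases _ It.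
  move=> z _; exists setT; first exact: filterT.
  apply: (@nearW _ (nbhs t)) => s [Is].
  by rewrite t0 ltNge (time_ge0 _ _ _ I_time Is).
have near0 := near_left_pos _ It t0.
apply: (outer_along_left_limits _ (near_left_left I t)) (vec_outer _ It t0) _.
- by apply: filterS near0 => s [Is s0]; exact: left_nbhs_proper I_time Is s0.
- by apply: filterS near0 => s [Is s0]; exact: vec_inner.
Qed.

(** Just after [t], the sets [G s] avoid a neighbourhood of a point outside
[G t], and so do their left limits. *)
Lemma vec_right_outer t : I t ->
  outer_along (strict_right_nbhs_in I t) vecG (G t).
Proof.
move=> It; have near0 := near_right_pos _ It.
apply: (outer_along_left_limits _ (near_right_left I t)) (G_outer _ It) _.
- by apply: filterS near0 => s [Is s0]; exact: left_nbhs_proper I_time Is s0.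
- by apply: filterS near0 => s [Is s0]; exact: vec_inner.
Qed.

(** Both right limits are [G t]: the outer limit is contained in it, and the left
versions of selections through [z] approach each of its points [z]. *)
Lemma vec_right_limits : has_right_limits T I vecG.
Proof.
move=> t It tT.
have inf_sup : right_liminf I vecG t `<=` right_limsup I vecG t.
  have [s sdown] := exists_seq_downto _ _ _ I_time It tT.
  move=> z /(_ s sdown)[u uz [N _ Gu]].
  exists s => //; exists (fun n => n + N)%N; split.
    by move=> n m; rewrite leEnat leq_add2r.
  exists (fun n => u (n + N)%N); last by move=> n; apply: Gu; exact: leq_addl.
  by rewrite (cvg_shiftn N u).
have sup_G : right_limsup I vecG t `<=` G t.
  move=> z [s sdown [phi [phi_incr [u uz Gu]]]].
  (* A strictly increasing sequence of naturals dominates the identity, so the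
     subsequence still tends to t. *)
  have phi_ge n : (n <= phi n)%N.
    elim: n => // n ih; apply: leq_ltn_trans ih _.
    by rewrite ltnNge -leEnat phi_incr ltnn.
  have phi_oo : phi @ \oo --> \oo.
    move=> P [N _ NP]; exists N => // n /= Nn; apply: NP.
    exact: leq_trans Nn (phi_ge n).
  apply: contrapT => /vec_right_outer-/(_ It)[U zU GU].
  have GsU : \forall n \near \oo, vecG (s (phi n)) `&` U = set0.
    exact: phi_oo _ (seq_downto_cvg _ _ _ sdown _ GU).
  have uU : \forall n \near \oo, U (u n) by exact: uz.
  have [n [Un GUn]] := filter_ex (filterI uU GsU).
  suff : (vecG (s (phi n)) `&` U) (u n) by rewrite GUn.
  by split=> //; exact: Gu.
have G_inf : G t `<=` right_liminf I vecG t.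
  move=> z Gz s sdown; have [y ysel yz] := selection_through _ _ It Gz.
  exists (left_version I y \o s).
    rewrite -yz; apply: cvg_comp (seq_downto_cvg _ _ _ sdown) _.
    exact: left_version_right_cvg ysel.1 It.
  by apply: nearW => n; apply: left_version_mem => //; have [] := sdown.
by apply/seteqP; split=> //; exact: subset_trans G_inf.
Qed.

Lemma vec_caglad : caglad_map T I vecG.
Proof.
have INy t : I t -> (-oo < t)%E.
  by move/(time_ge0 _ _ _ I_time); exact: lt_le_trans.
split; last exact: vec_right_limits.
- by apply: inner_left_isc => //; exact: vec_left_inner.
- by apply: outer_left_osc => //; [exact: vec_closed | exact: vec_left_outer].
Qed.

End cadlag_projection.

Theorem theorem16 (R : realType) (d : nat) (T : \bar R) (I : set (\bar R))
  (G : \bar R -> set 'rV[R]_d)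
  (T_gt0 : (0 < T)%E)
  (I_time : time_interval T I)
  (G_cadlag : cadlag_map I G)
  (G_nonempty : forall t, I t -> G t !=set0)
  (G_convex : forall t, I t -> @convex_set R 'rV[R]_d (G t))
  (G_left_nonempty : forall t, I t -> (0 < t)%E -> left_limsup I G t !=set0) :
  [/\ forall x : 'rV[R]_d, exists y : \bar R -> 'rV[R]_d,
        [/\ forall t, I t -> argmin_dist x (G t) = [set y t],
            cadlag_selection I G y &
            forall t, I t ->
              argmin_dist x (vec_map I G t) = [set left_version I y t]],
      forall t, I t -> G t = closure [set y t | y in cadlag_selection I G],
      [/\ caglad_map T I (vec_map I G),
          forall t, I t -> vec_map I G t !=set0 &
          forall t, I t -> @convex_set R 'rV[R]_d (vec_map I G t)] &
      forall t, I t ->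
        vec_map I G t =
          closure [set left_version I y t | y in cadlag_selection I G]].
Proof.
split.
- exact: (cadlag_projection I_time G_cadlag G_nonempty G_convex
    G_left_nonempty).
- move=> t It; apply/seteqP; split=> [z Gz|].
    apply: subset_closure.
    have [y ysel yz] := selection_through I_time G_cadlag G_nonempty G_convex
      G_left_nonempty z t It Gz.
    by exists y.
  have /closure_id -> := G_closed G_cadlag t It.
  by apply: closure_subset => _ [y [_ Gy] <-]; exact: Gy.
- split.
  + exact: (vec_caglad I_time G_cadlag G_nonempty G_convex G_left_nonempty).
  + exact: (vec_nonempty I_time G_cadlag G_left_nonempty).
  + exact: (vec_convex I_time G_convex).
- move=> t It; apply/seteqP; split=> [z Gz|].
    apply: subset_closure.
    have [y ysel yz] := selection_left_through I_time G_cadlag G_nonempty G_convex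
      G_left_nonempty z t It Gz.
    by exists y.
  have /closure_id -> := vec_closed I_time G_cadlag t It.
  apply: closure_subset => _ [y ysel <-].
  exact: (left_version_mem I_time G_cadlag).
Qed.
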